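(* Let $d=1$, so $\kappa(x,y)=1/(x-y)$, and let $\tilde\kappa(x,y)$ be its $N$-point proxy approximation with proxy surface the circle of radius $\gamma$ centered at $0$ (composite trapezoidal rule, as defined in the context). Let $X,Y\subset\mathbb{C}$ be finite nonempty sets of points. If $0<|x|<\gamma_1<\gamma<\gamma_2<|y|$ for all $x\in X$, $y\in Y$, then for any positive integer $N$, $$\frac{\lVert\tilde{K}^{(X,Y)}-K^{(X,Y)}\rVert_F}{\lVert K^{(X,Y)}\rVert_F}\leq g\!\left(\Big(\frac{\gamma}{\gamma_1}\Big)^N\right)+g\!\left(\Big(\frac{\gamma_2}{\gamma}\Big)^N\right).$$ Moreover, if the upper bound on the right-hand side is viewed as a function of $\gamma\in(\gamma_1,\gamma_2)$, it has a unique minimizer $\gamma^*=\sqrt{\gamma_1\gamma_2}$, and the minimum is $2\,g\!\left((\gamma_2/\gamma_1)^{N/2}\right)$, which decays asymptotically as $\mathcal{O}\!\left(|\gamma_2/\gamma_1|^{-N/2}\right)$.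
   Context: $g(z)=\frac{1}{z-1}$ for $z\neq 1$; $\|\cdot\|_F$ is the Frobenius norm. For a radius $\gamma>0$ and a positive integer $N$, the proxy points are $z_j=\gamma\exp\!\left(\frac{2j\pi\mathbf{i}}{N}\right)$, $j=1,\dots,N$ (with $\mathbf{i}=\sqrt{-1}$), and the proxy approximation of the kernel is $$\tilde\kappa(x,y)=\sum_{j=1}^{N}\kappa(x,z_j)\,\phi(z_j,y),\qquad \phi(z,y)=\frac{1}{N}\,\frac{z}{y-z}\quad(y\neq z).$$ $K^{(X,Y)}=(\kappa(x,y))_{x\in X,y\in Y}$ and $\tilde K^{(X,Y)}=(\tilde\kappa(x,y))_{x\in X,y\in Y}$. The asymptotics refer to $N\to\infty$. *)

(* Defs.v *)
From HB Require Import structures.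
From mathcomp Require Export all_boot all_order all_algebra finmap complex.
From mathcomp Require Export all_classical all_reals all_analysis.

Set Implicit Arguments.
Unset Strict Implicit.
Unset Printing Implicit Defensive.

Export Order.TTheory GRing.Theory Num.Theory.
Export numFieldNormedType.Exports.

Local Open Scope ring_scope.
Local Open Scope complex_scope.

(* [`|z|] on [R[i]] takes values in [R[i]]; [cabs] is the modulus in [R]. *)
Notation cabs := ComplexField.Normc.normc.

Definition cexp (R : realType) (z : R[i]) : R[i] :=
  (expR (complex.Re z))%:C * (cos (complex.Im z) +i* sin (complex.Im z)).

Definition frobenius_norm (R : realType) (m n : nat) (A : 'M[R[i]]_(m, n)) : R :=
  Num.sqrt (\sum_(i < m) \sum_(j < n) cabs (A i j) ^+ 2).

Definition g (F : fieldType) (z : F) : F := 1 / (z - 1).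

Definition kappa (F : fieldType) (x y : F) : F := 1 / (x - y).

Definition proxy_point (R : realType) (gamma : R) (N j : nat) : R[i] :=
  gamma%:C * cexp (2 * j%:R * pi%:C * 'i%C / N%:R).

Definition phi (F : fieldType) (N : nat) (z y : F) : F :=
  1 / N%:R * (z / (y - z)).

Definition proxy_kappa (R : realType) (gamma : R) (N : nat) (x y : R[i]) : R[i] :=
  \sum_(1 <= j < N.+1)
    kappa x (proxy_point gamma N j) * phi N (proxy_point gamma N j) y.

(* Rows and columns follow the library's enumeration of the finite sets, which
   is immaterial for the Frobenius norm. *)
Definition kernel_matrix (R : realType) (k : R[i] -> R[i] -> R[i])
    (X Y : {fset R[i]}) : 'M[R[i]]_(#|` X|, #|` Y|) :=
  \matrix_(i < #|` X|, j < #|` Y|) k X`_i Y`_j.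

Definition proxy_bound (R : realType) (gamma1 gamma2 : R) (N : nat)
    (gamma : R) : R :=
  g ((gamma / gamma1) ^+ N) + g ((gamma2 / gamma) ^+ N).

Definition is_minimizer (R : realType) (f : R -> R) (D : set R) (x : R) : Prop :=
  D x /\ forall y, D y -> f x <= f y.

(* Main.v *)
(* The proxy points are c w^j with w a primitive N-th root of unity.  Partial
   fractions and the sums of y / (y - c w^j) over j give the exact relative
   error (kappa~ - kappa) / kappa = g((y/c)^N) + g((c/x)^N), whose modulus is at
   most the bound since |g w| <= g |w| for |w| > 1; this pointwise estimate
   passes to Frobenius norms.  The two arguments of g in the bound have a
   product independent of gamma, so AM-GM locates the minimum where they are
   equal. *)
Require Import Defs.
From mathcomp Require Import ring lra.

Set Implicit Arguments.
Unset Strict Implicit.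
Unset Printing Implicit Defensive.

Local Open Scope classical_set_scope.
Local Open Scope complex_scope.
Local Open Scope ring_scope.

(** * Sums over the roots of unity and the exact error *)

(** The sum is geometric: its ratio [w ^+ k] differs from 1 because [N] does not divide [k], while
    the [N]-th power of the ratio is 1. *)
Lemma sum_prim_rootX (F : fieldType) (w : F) (N k : nat) :
  N.-primitive_root w -> (0 < k < N)%N ->
  \sum_(1 <= j < N.+1) (w ^+ k) ^+ j = 0.
Proof.
move=> hw /andP[k_gt0 k_ltN].
rewrite big_add1 /= big_mkord.
under eq_bigr do rewrite exprS.
rewrite -mulr_sumr; apply/eqP; rewrite mulf_eq0; apply/orP; right.
have wk1 : w ^+ k - 1 != 0.
  by rewrite subr_eq0 -(prim_order_dvd hw) gtnNdvd.
rewrite -(mulrI_eq0 _ (mulfI wk1)) -subrX1 exprAC (prim_expr_order hw).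
by rewrite expr1n subrr.
Qed.

(** Factoring y^N - (c w^j)^N turns 1 / (y - c w^j) into a polynomial in w^j of degree below N over
    the fixed denominator y^N - c^N. Summation over j then kills every power except the constant
    one. *)
Lemma sum_prim_root_pole (F : fieldType) (w c y : F) (N : nat) :
  N.-primitive_root w -> y ^+ N != c ^+ N ->
  \sum_(1 <= j < N.+1) y / (y - c * w ^+ j)
    = N%:R * (y ^+ N / (y ^+ N - c ^+ N)).
Proof.
move=> hw yc; have N_gt0 := prim_order_gt0 hw.
have d0 : y ^+ N - c ^+ N != 0 by rewrite subr_eq0.
have zN j : (c * w ^+ j) ^+ N = c ^+ N.
  by rewrite exprMn exprAC (prim_expr_order hw) expr1n mulr1.
have term j : y / (y - c * w ^+ j) =
    \sum_(i < N) y * y ^+ (N.-1 - i) * c ^+ i / (y ^+ N - c ^+ N) * (w ^+ i) ^+ j.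
  have yz : y - c * w ^+ j != 0.
    by apply: contraNneq yc => /subr0_eq ->; rewrite zN.
  apply: (mulIf yz); apply: (mulIf d0); rewrite divfK // -{1}(zN j) subrXX.
  rewrite mulrCA mulrC !(mulr_suml, mulr_sumr); apply: eq_bigr => i _.
  by rewrite exprMn [(w ^+ j) ^+ i]exprAC; field; rewrite d0.
under eq_bigr do rewrite term.
rewrite exchange_big /= (bigD1 (Ordinal N_gt0)) //= [X in _ + X]big1 ?addr0.
  rewrite -mulr_sumr expr0 subn0 -exprS prednK // mulr1.
  under eq_bigr do rewrite expr1n.
  by rewrite big_const_nat iter_addr addr0 subn1 mulrC.
move=> i i_neq0; rewrite -mulr_sumr sum_prim_rootX ?mulr0 // ltn_ord andbT lt0n.
by apply: contraNneq i_neq0 => i0; apply/eqP/val_inj.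
Qed.

(* Both pole sums come from the partial fractions
   (x - y) z / ((x - z)(y - z)) = y / (y - z) - x / (x - z). *)
Lemma proxy_sum_error (F : fieldType) (w c x y : F) (N : nat) :
  N.-primitive_root w -> N%:R != 0 :> F -> x != y ->
  x != 0 -> c != 0 -> x ^+ N != c ^+ N -> y ^+ N != c ^+ N ->
  \sum_(1 <= j < N.+1) kappa x (c * w ^+ j) * phi N (c * w ^+ j) y - kappa x y
    = kappa x y * (g ((y / c) ^+ N) + g ((c / x) ^+ N)).
Proof.
move=> hw N0 xy x0 c0 xc yc.
have zN j : (c * w ^+ j) ^+ N = c ^+ N.
  by rewrite exprMn exprAC (prim_expr_order hw) expr1n mulr1.
have xy0 : x - y != 0 by rewrite subr_eq0.
have term j : kappa x (c * w ^+ j) * phi N (c * w ^+ j) y =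
    (N%:R * (x - y))^-1 * (y / (y - c * w ^+ j))
    - (N%:R * (x - y))^-1 * (x / (x - c * w ^+ j)).
  have yz : y - c * w ^+ j != 0.
    by apply: contraNneq yc => /subr0_eq ->; rewrite zN.
  have xz : x - c * w ^+ j != 0.
    by apply: contraNneq xc => /subr0_eq ->; rewrite zN.
  rewrite /kappa /phi; field.
  by rewrite xz yz xy0 N0.
under eq_bigr do rewrite term.
rewrite sumrB -[X in X - _ - _]mulr_sumr -[X in _ - X - _]mulr_sumr.
rewrite !(sum_prim_root_pole hw) // /kappa /g !expr_div_n.
have xN0 : x ^+ N != 0 by rewrite expf_neq0.
have cN0 : c ^+ N != 0 by rewrite expf_neq0.
have cx : c ^+ N - x ^+ N != 0 by rewrite subr_eq0 eq_sym.
have ycN : y ^+ N - c ^+ N != 0 by rewrite subr_eq0.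
have xcN : x ^+ N - c ^+ N != 0 by rewrite subr_eq0.
field.
by rewrite !mulN1r xN0 cN0 cx ycN xy0 xcN N0.
Qed.

(** * The complex exponential and the proxy points *)

Lemma cexpD (R : realType) (u v : R[i]) : cexp (u + v) = cexp u * cexp v.
Proof.
case: u v => [a b] [c d]; rewrite /cexp /= expRD cosD sinD.
by simpc; congr (_ +i* _); ring.
Qed.

Lemma cexp0 (R : realType) : cexp (0 : R[i]) = 1.
Proof. by rewrite /cexp /= expR0 cos0 sin0; simpc. Qed.

Lemma cexp_mulrn (R : realType) (u : R[i]) (n : nat) :
  cexp (u *+ n) = cexp u ^+ n.
Proof.
by elim: n => [|n IHn]; rewrite ?mulr0n ?cexp0 // mulrS cexpD IHn exprS.
Qed.

(** The real part already differs from 1: cos t = 1 - 2 sin(t/2)^2, and sin(t/2) > 0 since 0 < t/2 <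
    pi. *)
Lemma cexp_imag_neq1 (R : realType) (t : R) :
  0 < t < 2 * pi -> cexp (0 +i* t) != 1.
Proof.
move=> /andP[t_gt0 t_lt2pi]; apply/eqP; rewrite /cexp /= expR0; simpc.
case=> cos1 _.
have s_gt0 : 0 < sin (t / 2) by apply: sin_gt0_pi; apply/andP; split; lra.
have : cos t = 1 - sin (t / 2) ^+ 2 *+ 2.
  rewrite {1}(_ : t = (t / 2) *+ 2); last by rewrite mulr2n; lra.
  by rewrite cos_mulr2n sin2cos2; ring.
have := exprn_gt0 2 s_gt0; rewrite cos1; lra.
Qed.

Definition unit_root (R : realType) (N : nat) : R[i] :=
  cexp (0 +i* (2 * pi / N%:R)).

Lemma natr_complex (R : realType) (n : nat) : n%:R = n%:R%:C :> R[i].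
Proof. by rewrite rmorph_nat. Qed.

Lemma unit_rootX (R : realType) (N k : nat) :
  unit_root R N ^+ k = cexp (0 +i* (2 * pi / N%:R * k%:R)).
Proof.
rewrite -cexp_mulrn; congr cexp.
by rewrite -[LHS]mulr_natr natr_complex; simpc.
Qed.

Lemma unit_root_primitive (R : realType) (N : nat) :
  (0 < N)%N -> N.-primitive_root (unit_root R N).
Proof.
move=> N_gt0; have N_gt0' : 0 < N%:R :> R by rewrite ltr0n.
(* Primitivity is tested on the exponents 1, ..., N: the N-th power is a full turn, and smaller
   exponents give angles strictly between 0 and 2 pi. *)
apply/andP; split=> //; apply/forallP => i; rewrite unity_rootE unit_rootX.
apply/eqP; have [->|iN] := eqVneq i.+1 N.
  rewrite divfK ?lt0r_neq0 //; apply/eqP.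
  by rewrite /cexp /= expR0 mulr_natl cos2pi sin2pi; simpc.
apply/negbTE/cexp_imag_neq1; apply/andP; split.
  by rewrite mulr_gt0 ?divr_gt0 ?mulr_gt0 ?pi_gt0 ?ltr0n.
rewrite -mulrA gtr_pMr ?mulr_gt0 ?pi_gt0 // mulrC ltr_pdivrMr // mul1r ltr_nat.
by rewrite ltn_neqAle iN ltn_ord.
Qed.

Lemma proxy_pointE (R : realType) (gamma : R) (N j : nat) :
  proxy_point gamma N j = gamma%:C * unit_root R N ^+ j.
Proof.
rewrite unit_rootX /proxy_point; congr (_ * cexp _).
rewrite !natr_complex -fmorphV /=; simpc.
by congr (_ +i* _); ring.
Qed.

(** * Estimates for moduli, Frobenius norms and [g] *)

Lemma cabs_ge0 (R : realType) (z : R[i]) : 0 <= cabs z.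
Proof. by case: z => a b; exact: sqrtr_ge0. Qed.

Lemma cabsX (R : realType) (z : R[i]) (n : nat) : cabs (z ^+ n) = cabs z ^+ n.
Proof.
elim: n => [|n IHn]; first by rewrite !expr0 ComplexField.Normc.normc1.
by rewrite !exprS ComplexField.Normc.normcM IHn.
Qed.

Lemma cabs_real (R : realType) (a : R) : 0 <= a -> cabs a%:C = a.
Proof. by move=> a0; rewrite /= expr0n addr0 sqrtr_sqr ger0_norm. Qed.

(** The triangle inequality gives |w - 1| >= |w| - 1 >= r - 1 > 0. Allowing [r] below |w| lets
    points at different distances share one bound. *)
Lemma cabs_g_le (R : realType) (w : R[i]) (r : R) :
  1 < r -> r <= cabs w -> cabs (g w) <= g r.
Proof.
move=> r_gt1 r_le; rewrite /g !div1r ComplexField.Normc.normcV.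
have le_w : cabs w <= cabs (w - 1) + 1.
  by rewrite -{1}[w](subrK 1) -(ComplexField.Normc.normc1 R) le_normcD.
by rewrite lef_pV2 ?posrE; lra.
Qed.

Lemma proxy_kappa_error (R : realType) (gamma1 gamma gamma2 : R) (N : nat)
    (x y : R[i]) :
  0 < gamma1 -> gamma1 < gamma < gamma2 -> (0 < N)%N ->
  0 < cabs x < gamma1 -> gamma2 < cabs y ->
  cabs (proxy_kappa gamma N x y - kappa x y)
    <= proxy_bound gamma1 gamma2 N gamma * cabs (kappa x y).
Proof.
move=> g1_gt0 /andP[g1g gg2] N_gt0 /andP[x_gt0 xg1] g2y.
have g_gt0 : 0 < gamma by lra.
have cg : cabs gamma%:C = gamma by rewrite cabs_real ?ltW.
have x0 : x != 0.
  by apply: contraTneq x_gt0 => ->; rewrite ComplexField.Normc.normc0 ltxx.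
have c0 : gamma%:C != 0 :> R[i]
  by rewrite eq_complex /= eqxx andbT gt_eqF.
(* Distinct moduli force distinct N-th powers, so neither x nor y meets a pole of the exact error
   formula. *)
have neqX (u v : R[i]) : cabs u < cabs v -> u ^+ N != v ^+ N.
  move=> uv; apply: contraTneq (uv) => e.
  have := ltrXn2r N (cabs_ge0 u) uv.
  by rewrite -!cabsX e ltxx -lt0n N_gt0.
have xy : x != y by apply: contraTneq xg1 => ->; rewrite -leNgt; lra.
under [proxy_kappa _ _ _ _]eq_bigr do rewrite proxy_pointE.
rewrite proxy_sum_error ?unit_root_primitive ?pnatr_eq0 -?lt0n //; first last.
- by rewrite eq_sym neqX // cg; lra.
- by rewrite neqX // cg; lra.
rewrite ComplexField.Normc.normcM mulrC ler_wpM2r ?cabs_ge0 //.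
(* The y-term of the error is matched with gamma2 / gamma and the x-term with gamma / gamma1. *)
rewrite /proxy_bound addrC (le_trans (le_normcD _ _)) // lerD //.
  apply: cabs_g_le; first by rewrite exprn_egt1 -?lt0n // ltr_pdivlMr // mul1r.
  rewrite cabsX ComplexField.Normc.normcM ComplexField.Normc.normcV cg.
  rewrite lerXn2r ?nnegrE ?mulr_ge0 ?invr_ge0 ?(ltW g_gt0) ?(ltW g1_gt0) ?cabs_ge0 //.
  by rewrite ler_pM2l // lef_pV2 ?posrE // ltW.
apply: cabs_g_le; first by rewrite exprn_egt1 -?lt0n // ltr_pdivlMr // mul1r.
rewrite cabsX ComplexField.Normc.normcM ComplexField.Normc.normcV cg.
have g2_ge0 : 0 <= gamma2 by lra.
rewrite lerXn2r ?nnegrE ?mulr_ge0 ?invr_ge0 ?(ltW g_gt0) ?cabs_ge0 //.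
by rewrite ler_pM2r ?invr_gt0 // ltW.
Qed.

Lemma frobenius_norm_le (R : realType) (m n : nat) (A B : 'M[R[i]]_(m, n))
    (c : R) :
  0 <= c -> (forall i j, cabs (A i j) <= c * cabs (B i j)) ->
  frobenius_norm A <= c * frobenius_norm B.
Proof.
move=> c0 AB; rewrite /frobenius_norm -(ger0_norm c0) -sqrtr_sqr.
rewrite -sqrtrM ?sqr_ge0 // ler_wsqrtr // mulr_sumr ler_sum // => i _.
rewrite mulr_sumr ler_sum // => j _; rewrite -exprMn lerXn2r ?nnegrE //.
- exact: cabs_ge0.
- by rewrite mulr_ge0 ?cabs_ge0.
Qed.

(* With s = a + b, the difference of the two sides is
   (q + 1)(s - 2q) / ((a - 1)(b - 1)(q - 1)), and s^2 - (2q)^2 = (a - b)^2. *)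
Lemma g_add_ge (R : realType) (a b q : R) :
  1 < a -> 1 < b -> 1 < q -> a * b = q ^+ 2 ->
  2 * g q <= g a + g b ?= iff (a == b).
Proof.
move=> a1 b1 q1 ab.
have a0 : a - 1 != 0 by rewrite subr_eq0 gt_eqF.
have b0 : b - 1 != 0 by rewrite subr_eq0 gt_eqF.
have q0 : q - 1 != 0 by rewrite subr_eq0 gt_eqF.
have s0 : a + b + 2 * q != 0 by rewrite gt_eqF //; lra.
have k_gt0 : 0 < (q + 1) / ((a - 1) * (b - 1) * (q - 1) * (a + b + 2 * q)).
  by rewrite divr_gt0 ?mulr_gt0 ?subr_gt0 //; lra.
have E : g a + g b - 2 * g q =
    (q + 1) / ((a - 1) * (b - 1) * (q - 1) * (a + b + 2 * q)) * (a - b) ^+ 2.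
  have -> : (a - b) ^+ 2 = (a + b + 2 * q) * (a + b - 2 * q).
    by rewrite mulrC -subr_sqr exprMn -ab; ring.
  transitivity (((a + b - 2) * (q - 1) - 2 * ((a - 1) * (b - 1)))
                / ((a - 1) * (b - 1) * (q - 1))).
    by rewrite /g; field; rewrite a0 b0 q0.
  have -> : (a + b - 2) * (q - 1) - 2 * ((a - 1) * (b - 1))
      = (q + 1) * (a + b - 2 * q) + 2 * (q ^+ 2 - a * b) by ring.
  by rewrite ab; field; rewrite a0 b0 q0 s0.
split; first by rewrite -subr_ge0 E mulr_ge0 ?sqr_ge0 ?ltW.
by rewrite eq_sym -subr_eq0 E mulf_eq0 gt_eqF //= sqrf_eq0 subr_eq0.
Qed.

(** * The optimal radius and the decay of the minimum *)

Lemma powR_gt1 (R : realType) (a s : R) : 1 < a -> 0 < s -> 1 < a `^ s.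
Proof.
move=> a1 s0; rewrite -[ltLHS](_ : 1 `^ s = 1); last by rewrite powR1.
by apply: gt0_ltr_powR; rewrite ?nnegrE //; lra.
Qed.

(** The two arguments of [g] multiply to (gamma2 / gamma1)^N, the square of the argument on the
    left. They coincide exactly when gamma^2 = gamma1 gamma2, so the equality case yields both the
    minimum and its uniqueness. *)
Lemma proxy_bound_ge (R : realType) (gamma1 gamma2 gamma : R) (N : nat) :
  0 < gamma1 -> gamma1 < gamma < gamma2 -> (0 < N)%N ->
  2 * g ((gamma2 / gamma1) `^ (N%:R / 2)) <= proxy_bound gamma1 gamma2 N gamma
    ?= iff (gamma == Num.sqrt (gamma1 * gamma2)).
Proof.
move=> g1_gt0 /andP[g1g gg2] N_gt0.
have g_gt0 : 0 < gamma by lra.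
have g2_gt0 : 0 < gamma2 by lra.
have r_gt1 : 1 < gamma2 / gamma1 by rewrite ltr_pdivlMr // mul1r; lra.
have -> : (gamma == Num.sqrt (gamma1 * gamma2)) =
    ((gamma / gamma1) ^+ N == (gamma2 / gamma) ^+ N).
  rewrite [RHS]eqrXn2 ?divr_ge0 ?(ltW g1_gt0) ?(ltW g2_gt0) ?(ltW g_gt0) //.
  rewrite eqr_div ?lt0r_neq0 // -expr2 -[LHS](eqrXn2 (n := 2)) ?sqrtr_ge0 ?(ltW g_gt0) //.
  by rewrite sqr_sqrtr ?mulr_ge0 ?(ltW g1_gt0) ?(ltW g2_gt0) // [gamma2 * _]mulrC.
apply: g_add_ge.
- by rewrite exprn_egt1 -?lt0n // ltr_pdivlMr // mul1r.
- by rewrite exprn_egt1 -?lt0n // ltr_pdivlMr // mul1r.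
- by rewrite powR_gt1 ?divr_gt0 ?ltr0n.
rewrite -[RHS]powR_mulrn ?powR_ge0 // -powRrM divfK ?pnatr_eq0 // powR_mulrn; last lra.
by rewrite -exprMn; congr (_ ^+ _); field; rewrite !gt_eqF.
Qed.

Lemma sqrt_mul_between (R : realType) (a b : R) :
  0 < a -> a < b -> a < Num.sqrt (a * b) < b.
Proof.
move=> a0 ab; have b0 : 0 < b by lra.
rewrite -{1}(ger0_norm (ltW a0)) -{3}(ger0_norm (ltW b0)) -!sqrtr_sqr.
by rewrite !ltr_sqrt ?exprn_gt0 ?mulr_gt0 // !expr2 ltr_pM2l // ltr_pM2r // ab.
Qed.

Lemma g_powR_bigO (R : realType) (r : R) : 1 < r ->
  (fun N : nat => 2 * g (r `^ (N%:R / 2)) : R^o) =O_\oo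
    (fun N : nat => `|r| `^ (- (N%:R / 2)) : R^o).
Proof.
move=> r1; have q1 : 1 < r `^ 2^-1 by rewrite powR_gt1 ?invr_gt0.
set p := r `^ 2^-1 in q1.
(* With q = r^(N/2), the ratio of 1 / (q - 1) to 1 / q is q / (q - 1), which decreases in q and is
   thus at most p / (p - 1) once q >= p. *)
apply/eqO_exP; exists (2 * (p / (p - 1))).
  by rewrite mulr_gt0 // divr_gt0; lra.
(* At N = 0 one has q = 1 < p, hence the start at 1. *)
exists 1%N => // N /= N_gt0.
have : p <= r `^ (N%:R / 2).
  by apply: ler_powR; rewrite ?ler_peMl ?invr_ge0 ?ler1n // ltW.
rewrite (ger0_norm (ltW (lt_trans ltr01 r1))) powRN.
set q := _ `^ _ => pq.
have g_ge0 : 0 <= 2 * g q by rewrite /g mulr_ge0 // div1r invr_ge0; lra.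
have V_ge0 : 0 <= q^-1 by rewrite invr_ge0; lra.
rewrite [leLHS](ger0_norm g_ge0) [X in _ <= _ * X](ger0_norm V_ge0).
rewrite /g -mulrA ler_pM2l // div1r -subr_ge0.
rewrite (_ : _ - _ = (q - p) / ((p - 1) * (q - 1) * q)).
  by rewrite divr_ge0 ?mulr_ge0; lra.
by field; rewrite !gt_eqF; lra.
Qed.

Theorem proposition3p1 (R : realType) (X Y : {fset R[i]}) (gamma1 gamma2 : R)
    (X_neq0 : X != fset0) (Y_neq0 : Y != fset0)
    (lt_gamma12 : gamma1 < gamma2)
    (X_in : forall x : R[i], x \in X -> 0 < cabs x < gamma1)
    (Y_out : forall y : R[i], y \in Y -> gamma2 < cabs y) :
  (forall (gamma : R) (N : nat), gamma1 < gamma < gamma2 -> (0 < N)%N ->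
     frobenius_norm (kernel_matrix (proxy_kappa gamma N) X Y
                     - kernel_matrix (@kappa R[i]) X Y)
       / frobenius_norm (kernel_matrix (@kappa R[i]) X Y)
     <= proxy_bound gamma1 gamma2 N gamma) /\
  (forall N : nat, (0 < N)%N ->
     (forall gamma : R,
        is_minimizer (proxy_bound gamma1 gamma2 N)
          [set t | gamma1 < t < gamma2] gamma
        <-> gamma = Num.sqrt (gamma1 * gamma2)) /\
     proxy_bound gamma1 gamma2 N (Num.sqrt (gamma1 * gamma2))
       = 2 * g ((gamma2 / gamma1) `^ (N%:R / 2))) /\
  (fun N : nat => 2 * g ((gamma2 / gamma1) `^ (N%:R / 2)) : R^o) =O_\oo
    (fun N : nat => `|gamma2 / gamma1| `^ (- (N%:R / 2)) : R^o).
Proof.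
have /fset0Pn[x0 x0X] := X_neq0.
(* Positivity of [gamma1] is read off from a point of [X]. *)
have g1_gt0 : 0 < gamma1 by have /andP[] := X_in _ x0X; apply: lt_trans.
have r_gt1 : 1 < gamma2 / gamma1 by rewrite ltr_pdivlMr // mul1r.
have midP := sqrt_mul_between g1_gt0 lt_gamma12.
split; last split; last exact: g_powR_bigO.
- move=> gamma N gammaP N_gt0.
  have bound_ge0 : 0 <= proxy_bound gamma1 gamma2 N gamma.
    apply: le_trans (proxy_bound_ge g1_gt0 gammaP N_gt0).1.
    rewrite /g mulr_ge0 // div1r invr_ge0 subr_ge0 ltW //.
    by rewrite powR_gt1 ?divr_gt0 ?ltr0n.
  set K := kernel_matrix (@kappa _) X Y; set A := _ - K.
  have AK : frobenius_norm A <= proxy_bound gamma1 gamma2 N gamma * frobenius_norm K.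
    apply: frobenius_norm_le => // i j; rewrite !mxE.
    by apply: proxy_kappa_error => //; [apply: X_in|apply: Y_out]; apply: mem_nth.
  (* Division by a zero norm yields 0, which the nonnegative bound dominates. *)
  have [->|K0] := eqVneq (frobenius_norm K) 0; first by rewrite invr0 mulr0.
  by rewrite ler_pdivrMr // lt_neqAle eq_sym K0 sqrtr_ge0.
- move=> N N_gt0.
  have val : proxy_bound gamma1 gamma2 N (Num.sqrt (gamma1 * gamma2))
       = 2 * g ((gamma2 / gamma1) `^ (N%:R / 2)).
    by have [_] := proxy_bound_ge g1_gt0 midP N_gt0; rewrite eqxx => /eqP.
  (* A minimizer is compared with the geometric mean, which lies in the interval: its value is then
     squeezed onto the lower bound, and the equality case identifies it. *)
  split=> // gamma; split=> [[gammaP /(_ _ midP)]|->].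
    rewrite val => le_b; have [ge_b] := proxy_bound_ge g1_gt0 gammaP N_gt0.
    by rewrite eq_le ge_b le_b => /esym/eqP.
  by split=> // t tP; rewrite val; exact: (proxy_bound_ge g1_gt0 tP N_gt0).1.
Qed.
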